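(* Let $a,b\in\mathbb N$ with $b\mid a$, let $\sigma$ be a $b$-core, and for $k\in\mathbb N$ let $$N_\sigma(k)=\#\{\lambda\in\mathcal C_a:\ \mathrm{core}_b\lambda=\sigma,\ \ell(\lambda)\le k\}.$$ Then there is a quasipolynomial $Q_\sigma(k)$ of degree $a-b$ and period $b$ such that $N_\sigma(k)=Q_\sigma(k)$ for all integers $k\ge\ell(\sigma)$. The leading coefficient of $Q_\sigma$ is $\dfrac{1}{\left((\frac ab-1)!\right)^{b}}$.
   Context: A partition $\lambda=(a_1,\dots,a_\ell)$ is a weakly decreasing finite sequence of positive integers; $\ell(\lambda)=\ell$ is its length. For $t\in\mathbb N$, a $t$-core is a partition whose Young diagram has no hook of size $t$; $\mathcal C_t$ is the set of $t$-cores, and $\mathrm{core}_t\lambda$ is obtained from $\lambda$ by successively removing rim hooks (border strips) of size $t$ until none remain (independent of choices). A function $Q:\mathbb N\to\mathbb Q$ is a quasipolynomial of period $p$ if for each $0\le i<p$ the function $n\mapsto Q(i+np)$ ($n\ge0$) is a polynomial $P_i$; its degree is the maximum degree of the $P_i$. ''The leading coefficient of $Q$ is $c$'' means each $P_i$ (for the stated period) has degree equal to that of $Q$ and leading coefficient $c$. *)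

(* Defs.v *)
From mathcomp Require Import all_boot all_order all_algebra.
Set Implicit Arguments. Unset Strict Implicit. Unset Printing Implicit Defensive.

Definition is_partition (l : seq nat) : bool :=
  sorted geq l && all (fun x => 0 < x) l.

Definition row (l : seq nat) (i : nat) : nat := nth 0 l i.

Definition col (l : seq nat) (j : nat) : nat := count (fun x => j < x) l.

(* hook length of cell (i,j) (with j < row l i): arm + leg + 1 *)
Definition hook (l : seq nat) (i j : nat) : nat :=
  (row l i - j.+1) + (col l j - i.+1) + 1.

Definition is_core (t : nat) (l : seq nat) : bool :=
  ~~ has (fun i => has (fun j => hook l i j == t) (iota 0 (row l i)))
         (iota 0 (size l)).

Definition skew_cell (lam mu : seq nat) (c : nat * nat) : bool :=
  (row mu c.1 <= c.2) && (c.2 < row lam c.1).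

Definition cell_adj (c d : nat * nat) : bool :=
  ((c.1 == d.1) && ((c.2.+1 == d.2) || (d.2.+1 == c.2))) ||
  ((c.2 == d.2) && ((c.1.+1 == d.1) || (d.1.+1 == c.1))).

(* mu is obtained from lam by removing a rim hook (border strip) of size t:
   lam/mu is a skew shape of size t, edge-connected, containing no 2x2 square. *)
Definition rim_hook_removal (t : nat) (lam mu : seq nat) : Prop :=
  [/\ is_partition mu,
      forall i, row mu i <= row lam i,
      sumn lam = sumn mu + t,
      (forall i j, ~~ [&& skew_cell lam mu (i, j), skew_cell lam mu (i.+1, j),
                          skew_cell lam mu (i, j.+1) & skew_cell lam mu (i.+1, j.+1)])
    & (forall c d, skew_cell lam mu c -> skew_cell lam mu d ->
         exists p : seq (nat * nat),
           path (fun x y => cell_adj x y && skew_cell lam mu y) c p /\ last c p = d)].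

Inductive rim_hook_chain (t : nat) : seq nat -> seq nat -> Prop :=
| rhc_refl l : rim_hook_chain t l l
| rhc_step l m n : rim_hook_removal t l m -> rim_hook_chain t m n ->
                   rim_hook_chain t l n.

(* core_t lam = sigma : sigma is a t-core reached from lam by successively
   removing rim hooks of size t (the result is independent of choices). *)
Definition core_is (t : nat) (lam sigma : seq nat) : Prop :=
  rim_hook_chain t lam sigma /\ is_core t sigma.

Definition card_is (P : seq nat -> Prop) (n : nat) : Prop :=
  exists s : seq (seq nat), uniq s /\ (forall x, x \in s <-> P x) /\ size s = n.

(* Main.v *)
(* Record a partition with at most k parts by its k beads {l_i + k - 1 - i}.  It is a
   t-core iff the bead set is closed under subtracting t, and removing a rim hook of
   size t moves one bead from x to a free position x - t; hence, for k >= l(sigma),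
   core_b l = sigma iff l and sigma have the same number n_r of beads congruent to r
   mod b, for each r.  Put m = a / b.  A bead set closed under -a is determined by its
   bead counts c_s on the residue classes s mod a, which are arbitrary; the condition
   on the b-core says that the m counts c_s with s = r mod b add up to n_r.  Therefore
   N(k) = prod_(r < b) 'C(n_r + m - 1, m - 1), and replacing k by k + b increases every
   n_r by one. *)
Require Import Defs.
From mathcomp Require Import all_boot all_order all_algebra.
From mathcomp Require Import zify ring.
Import GRing.Theory Num.Theory.
(* [all_algebra] shadows [Defs.row]. *)
Import Defs.
Set Implicit Arguments. Unset Strict Implicit. Unset Printing Implicit Defensive.

(** * Beads *)

Lemma sorted_geq_nthS s i : sorted geq s -> nth 0 s i.+1 <= nth 0 s i.
Proof.
move=> ss; have [lt_is|le_si] := ltnP i.+1 (size s); last by rewrite nth_default.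
by move/(sortedP 0): ss; apply.
Qed.

Lemma sorted_geq_nth s i j : sorted geq s -> i <= j -> nth 0 s j <= nth 0 s i.
Proof.
move=> ss /subnK <-; elim: (j - i) => // n IHn.
by rewrite addSn (leq_trans (sorted_geq_nthS _ ss)).
Qed.

Lemma sorted_gtn_geq s : sorted gtn s -> sorted geq s.
Proof. by apply: sub_sorted => x y /ltnW. Qed.

(** In a weakly decreasing list the entries beyond [v] form a prefix; the default 0 is never beyond
    [v]. Applied to parts this is conjugation ([row_gtP]), applied to beads it is [bead_gtP]. *)
Lemma sorted_ltn_count s v i :
  sorted geq s -> (i < count (ltn v) s) = (v < nth 0 s i).
Proof.
elim: s i => [|x s IHs] i ss; first by rewrite nth_nil.
have tr : transitive geq by move=> ? ? ? /[swap]; apply: leq_trans.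
have := ss; rewrite /= (path_sortedE tr) => /andP[/allP xs {}/IHs IHs].
case: i => [|i] /=; last first.
  case: (ltnP v x) => [vx|xv] /=; first by rewrite add1n ltnS IHs.
  rewrite add0n; have /= := sorted_geq_nth ss (leq0n i.+1).
  move=> /leq_trans/(_ xv) nv; rewrite [RHS]ltnNge nv; apply/negbTE.
  rewrite -leqNgt; suff /eqP-> : count (ltn v) s == 0 by [].
  rewrite -leqn0 leqNgt -has_count; apply/hasPn => y /xs yx.
  by rewrite /= -leqNgt (leq_trans yx).
case: (ltnP v x) => //= xv; apply/negbTE; rewrite -leqNgt leqn0 -leqn0 leqNgt -has_count.
by apply/hasPn => y /xs yx; rewrite -leqNgt (leq_trans yx).
Qed.

Definition bead k (l : seq nat) i := row l i + (k - i.+1).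
Definition beads k l := mkseq (bead k l) k.

Lemma size_beads k l : size (beads k l) = k.
Proof. by rewrite size_mkseq. Qed.

Lemma nth_beads k l i : i < k -> nth 0 (beads k l) i = bead k l i.
Proof. exact: nth_mkseq. Qed.

Lemma row_leq l i j : is_partition l -> i <= j -> row l j <= row l i.
Proof. by move=> /andP[sl _]; apply: sorted_geq_nth. Qed.

Lemma row_default l i : size l <= i -> row l i = 0.
Proof. exact: nth_default. Qed.

Lemma row_gt0 l i : is_partition l -> (0 < row l i) = (i < size l).
Proof.
case/andP=> _ /allP pl; have [il|li] := ltnP i (size l); last by rewrite row_default.
exact/pl/mem_nth.
Qed.

Lemma beads_sorted k l : is_partition l -> sorted gtn (beads k l).
Proof.
move=> pl; apply/(sortedP 0) => i; rewrite size_beads => ik.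
rewrite !nth_beads ?(ltnW ik) //= /bead.
by have := row_leq pl (leqnSn i); lia.
Qed.

Lemma beads_uniq k l : is_partition l -> uniq (beads k l).
Proof.
move=> pl; apply: (sorted_uniq _ _ (beads_sorted k pl)) => [x y z|x]; rewrite /= ?ltnn //.
by move=> xy /ltn_trans; apply.
Qed.

Lemma partition_eq_row l l' :
  is_partition l -> is_partition l' -> (forall i, row l i = row l' i) -> l = l'.
Proof.
move=> pl pl' e; apply: (@eq_from_nth _ 0) => [|i _]; last exact: e.
apply/eqP; rewrite eqn_leq; apply/andP; split; rewrite leqNgt.
  by rewrite -row_gt0 // e row_gt0 // ltnn.
by rewrite -row_gt0 // -e row_gt0 // ltnn.
Qed.

Lemma beads_inj k l l' :
  is_partition l -> is_partition l' -> size l <= k -> size l' <= k ->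
  beads k l =i beads k l' -> l = l'.
Proof.
move=> pl pl' lk lk' e; apply: partition_eq_row => // i.
have [ik|ki] := ltnP i k; last by rewrite !row_default ?(leq_trans _ ki).
have {}e : beads k l = beads k l'.
  apply: (irr_sorted_eq (leT := gtn)) e; rewrite ?beads_sorted //.
    by move=> x y z /= xy /ltn_trans; apply.
  by move=> x /=; rewrite ltnn.
by have := congr1 (nth 0 ^~ i) e; rewrite !nth_beads // /bead => /addIn.
Qed.

(** Inverse of [beads]: sort decreasingly, subtract the staircase, drop the zero parts. *)
Definition part_of_beads (s : seq nat) : seq nat :=
  let s' := sort geq s in
  [seq x <- mkseq (fun i => nth 0 s' i - (size s - i.+1)) (size s) | 0 < x].

Lemma part_of_beadsP s (l := part_of_beads s) : uniq s ->
  [/\ is_partition l, size l <= size s & perm_eq (beads (size s) l) s].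
Proof.
move=> us; rewrite /l /part_of_beads.
set s' := sort geq s; set k := size s.
have ps : perm_eq s' s by rewrite /s' perm_sort.
have sz : size s' = k by apply: perm_size.
have us' : uniq s' by rewrite (perm_uniq ps).
have tot : total geq by move=> x y /=; apply: leq_total.
have ss' : sorted gtn s'.
  have: sorted geq s' by apply: sort_sorted.
  move=> so; apply/(sortedP 0) => i il /=; rewrite ltn_neqAle.
  move/(sortedP 0): so => /(_ i il) /= ->; rewrite andbT.
  by rewrite nth_uniq ?(ltnW il) //; lia.
set f := fun i => nth 0 s' i - (k - i.+1).
have hd i : i.+1 < k -> nth 0 s' i.+1 < nth 0 s' i.
  by move/(sortedP 0): ss' => ss' ik; apply: ss'; rewrite sz.
(* Exactly [k - i.+1] of the distinct naturals in [s'] come after position [i], so the truncated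
   subtraction in [f] is exact. The induction starts from the smallest entry. *)
have fl i : i < k -> k - i.+1 <= nth 0 s' i.
  have fl' j : j < k -> j <= nth 0 s' (k - j.+1).
    elim: j => // j IHj jk; apply: (leq_ltn_trans (IHj (ltnW jk))).
    by have := hd (k - j.+2); rewrite (_ : (k - j.+2).+1 = k - j.+1); [apply; lia|lia].
  move=> ik; have := fl' (k - i.+1).
  by rewrite (_ : k - (k - i.+1).+1 = i); [apply; lia|lia].
have sf : sorted geq (mkseq f k).
  apply/(sortedP 0) => i; rewrite size_mkseq => ik; rewrite !nth_mkseq ?(ltnW ik) //=.
  by have := hd _ ik; rewrite /f; lia.
have tr : transitive geq by move=> ? ? ? /[swap]; apply: leq_trans.
(* The zeros form a suffix, so filtering shifts no positive part, and the default 0 stands in for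
   what was dropped. *)
have rowE i : nth 0 [seq x <- mkseq f k | 0 < x] i = nth 0 (mkseq f k) i.
  elim: (mkseq f k) sf i => // x t IHt /=; rewrite (path_sortedE tr) => /andP[/allP xt st] i.
  case: posnP => [x0|x0]; last by case: i => //= i; apply: IHt.
  rewrite IHt // x0; case: i => [|i] /=.
    by case: t xt {IHt st} => //= y t /(_ y); rewrite inE eqxx x0 => /(_ isT); lia.
  have z j : nth 0 t j = 0.
    have [jt|] := ltnP j (size t); last exact: nth_default.
    by have := xt _ (mem_nth 0 jt); rewrite /= x0; lia.
  by rewrite !z.
split.
- by rewrite /is_partition filter_all sorted_filter.
- by rewrite size_filter (leq_trans (count_size _ _)) // size_mkseq.
suff -> : beads k [seq x <- mkseq f k | 0 < x] = s' by [].
apply: (@eq_from_nth _ 0) => [|i]; rewrite size_beads ?sz // => ik.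
by rewrite nth_beads // /bead /row rowE nth_mkseq // /f subnK // fl.
Qed.

Lemma bead_gtP k l v i : is_partition l -> i < k ->
  (v < bead k l i) = (i < count (ltn v) (beads k l)).
Proof.
by move=> pl ik; rewrite sorted_ltn_count ?nth_beads // sorted_gtn_geq ?beads_sorted.
Qed.

Lemma row_gtP l i j : is_partition l -> (j < row l i) = (i < col l j).
Proof. by case/andP=> sl _; rewrite /row -(sorted_ltn_count j i sl). Qed.

Lemma mem_beadsP k l x :
  reflect (exists2 i, i < k & x = bead k l i) (x \in beads k l).
Proof.
apply: (iffP mapP) => [[i]|[i ik ->]]; rewrite ?mem_iota; first by exists i.
by exists i; rewrite ?mem_iota.
Qed.

Lemma sumn_beads k l : size l <= k ->
  sumn (beads k l) = sumn l + \sum_(i < k) (k - i.+1).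
Proof.
move=> lk; have -> : sumn l = \sum_(i < k) row l i.
  rewrite sumnE (big_nth 0) big_mkord (big_ord_widen k (fun i => nth 0 l i) lk).
  rewrite [RHS](bigID (fun i : 'I_k => i < size l)) /= [X in _ = _ + X]big1 ?addn0 //.
  by move=> i; rewrite -leqNgt; apply: row_default.
by rewrite -big_split sumnE big_map /index_iota -(big_mkord xpredT (bead k l)) /index_iota subn0.
Qed.

(** * Cores and closed bead sets *)

Lemma col_leq_size l j : col l j <= size l.
Proof. exact: count_size. Qed.

(* [j + (k - col l j)] is the [j]-th free position; hooks in column [j] are the distances
   from larger beads to it. *)
Lemma gap_notin_beads k l j : is_partition l -> size l <= k ->
  j + (k - col l j) \notin beads k l.
Proof.
move=> pl lk; apply/mem_beadsP => -[i ik]; rewrite /bead.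
have := col_leq_size l j; have := row_gtP i j pl.
by case: (ltnP j (row l i)); case: (ltnP i (col l j)) => //; lia.
Qed.

Lemma hook_gap k l i j : is_partition l -> size l <= k -> j < row l i ->
  hook l i j + (j + (k - col l j)) = bead k l i.
Proof.
move=> pl lk ji; have := ji; rewrite row_gtP // => ic.
by rewrite /hook /bead; have := col_leq_size l j; lia.
Qed.

(** With [c] beads beyond the free position [y], there are [k - c] beads below it, hence [y + c - k]
    free positions below it. This number is the column index [j], and that column has length [c]. *)
Lemma gap_of_notin k l i y : is_partition l -> size l <= k -> i < k ->
  y < bead k l i -> y \notin beads k l ->
  exists2 j, j < row l i & y = j + (k - col l j).
Proof.
move=> pl lk ik; rewrite bead_gtP //; set c := count _ _ => ic yX.
have ck : c <= k by rewrite (leq_trans (count_size _ _)) ?size_beads.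
have bc : c < k -> bead k l c < y.
  move=> c_k; rewrite ltn_neqAle; apply/andP; split.
    by apply: contraNneq yX => <-; apply/mem_beadsP; exists c.
  by rewrite leqNgt bead_gtP // ltnn.
have b1 : y < bead k l c.-1 by rewrite bead_gtP // -/c; lia.
have kcy : k - c <= y by have := bc; rewrite /bead; lia.
have cE : col l (y + c - k) = c.
  apply/eqP; rewrite eqn_leq; apply/andP; split.
    rewrite leqNgt -row_gtP //.
    have [c_k|kc] := ltnP c k; first by have := bc c_k; rewrite /bead; lia.
    by rewrite row_default ?(leq_trans lk).
  suff : c.-1 < col l (y + c - k) by lia.
  by rewrite -row_gtP //; move: b1; rewrite /bead; lia.
by exists (y + c - k); rewrite ?row_gtP ?cE //; lia.
Qed.

(** By [hook_gap] and [gap_of_notin], the hook lengths in row [i] are exactly the distances from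
    bead [i] down to the free positions below it. *)
Lemma coreP t k l : 0 < t -> is_partition l -> size l <= k ->
  reflect (forall x, x \in beads k l -> t <= x -> x - t \in beads k l)
          (is_core t l).
Proof.
move=> t0 pl lk; apply: (iffP idP) => [ct x|cl].
  case/mem_beadsP=> i ik -> tx; apply: contraT => xX.
  have [|j ji e] := gap_of_notin pl lk ik _ xX; first by lia.
  case/negP: ct; apply/hasP; exists i; first by rewrite mem_iota -row_gt0 //; lia.
  apply/hasP; exists j; first by rewrite mem_iota.
  by have := hook_gap pl lk ji; lia.
apply/negP => /hasP[i]; rewrite mem_iota => il /hasP[j]; rewrite mem_iota => ji /eqP ht.
have {}ji : j < row l i by lia.
have ik : i < k by lia.
have := gap_notin_beads j pl lk; have e := hook_gap pl lk ji.
rewrite (_ : j + _ = bead k l i - t); last by lia.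
by rewrite cl //; [apply/mem_beadsP; exists i | lia].
Qed.

(** A closed set meets each residue class in an initial segment, so membership only compares the
    rank [x %/ t] within the class to the length of that segment. *)
Lemma closed_memE t (X : seq nat) : 0 < t -> uniq X ->
  (forall x, x \in X -> t <= x -> x - t \in X) ->
  forall x, (x \in X) = (x %/ t < count (fun y => y %% t == x %% t) X).
Proof.
move=> t0 uX cl x.
have down n i : i <= n -> x %% t + t * n \in X -> x %% t + t * i \in X.
  elim: n => [|n IHn] in_; first by have -> : i = 0 by lia.
  move: in_; rewrite leq_eqVlt => /predU1P[->//|/IHn{}IHn /cl IH].
  apply: IHn; have := IH _; rewrite (_ : _ - t = x %% t + t * n); [apply|]; lia.
have uL n : uniq [seq x %% t + t * i | i <- iota 0 n].
  by rewrite map_inj_uniq ?iota_uniq // => i j /addnI /eqP; rewrite eqn_pmul2l // => /eqP.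
have sL n : size [seq x %% t + t * i | i <- iota 0 n] = n by rewrite size_map size_iota.
have eL i : (x %% t + t * i) %% t = x %% t by rewrite addnC mulnC modnMDl modn_mod.
have xE y : y %% t = x %% t -> y = x %% t + t * (y %/ t).
  by move=> <-; rewrite addnC mulnC -divn_eq.
(* If [x] is in [X], its class in [X] contains all ranks up to [x %/ t]; otherwise it contains only
   smaller ranks. *)
rewrite -size_filter; have [xX|xX] := boolP (x \in X).
  rewrite -[X in X <= _](sL (x %/ t).+1); apply/esym; apply: uniq_leq_size => // y /mapP[i].
  rewrite mem_iota => ix ->; rewrite mem_filter eL eqxx /=.
  by apply: (down (x %/ t)); rewrite -?xE //; lia.
apply/esym/negbTE; rewrite -leqNgt -[X in _ <= X](sL (x %/ t)).
apply: uniq_leq_size => [|y]; rewrite ?filter_uniq // mem_filter => /andP[/eqP yx yX].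
apply/mapP; exists (y %/ t); last exact: xE.
rewrite mem_iota /= add0n ltnNge; apply: contra xX => xy.
by rewrite [x]xE //; apply: (down (y %/ t)); rewrite -?xE.
Qed.

Definition residue_count t r (X : seq nat) := count (fun x => x %% t == r) X.

Lemma closed_eq t (X Y : seq nat) : 0 < t -> uniq X -> uniq Y ->
  (forall x, x \in X -> t <= x -> x - t \in X) ->
  (forall x, x \in Y -> t <= x -> x - t \in Y) ->
  (forall r, r < t -> residue_count t r X = residue_count t r Y) -> X =i Y.
Proof.
move=> t0 uX uY cX cY e x; rewrite (closed_memE t0 uX cX) (closed_memE t0 uY cY).
by have := e (x %% t) (ltn_pmod _ t0); rewrite /residue_count => ->.
Qed.

(** * Removing a rim hook preserves residue counts *)

(** [E] lists [t] consecutive integers: two distinct congruent elements would force at least [t.+1]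
    elements between them, ends included, so reduction mod [t] is a bijection from [E] onto the
    residues. *)
Lemma interval_residue_count t r (E : seq nat) :
  uniq E -> size E = t ->
  (forall x v z, x \in E -> z \in E -> x <= v <= z -> v \in E) ->
  r < t -> residue_count t r E = 1.
Proof.
move=> uE sE iE rt.
have inj : {in E &, injective (modn^~ t)}.
  suff H x y : x \in E -> y \in E -> x %% t = y %% t -> x <= y -> x = y.
    move=> x y xE yE e; case/orP: (leq_total x y) => [|/H->//]; exact: H.
  move=> xE yE /eqP; rewrite eq_sym => e xy; move: e; rewrite eqn_mod_dvd // => ty.
  apply/eqP; rewrite eqn_leq xy /= -subn_eq0; apply: contraT; rewrite -lt0n => /dvdn_leq/(_ ty) txy.
  have := @uniq_leq_size _ (iota x t.+1) E (iota_uniq _ _); rewrite size_iota sE ltnn; apply.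
  by move=> v; rewrite mem_iota => xv; apply: (iE x v y) => //; lia.
have u : uniq (map (modn^~ t) E) by rewrite map_inj_in_uniq.
have /uniq_min_size := u => /(_ (iota 0 t)); rewrite size_map sE size_iota leqnn => -[|//|_ mE].
  by move=> v /mapP[x _ ->]; rewrite mem_iota /= ltn_mod; lia.
rewrite /residue_count -(count_map (modn^~ t) (pred1 r)) count_uniq_mem //.
by rewrite mE mem_iota rt.
Qed.

(* The content j - i of a cell, shifted by k - 1 so as to be a natural number. *)
Definition content k (c : nat * nat) := c.2 + (k - c.1.+1).

Definition skew_contents k l mu : seq nat :=
  flatten [seq iota (bead k mu i) (bead k l i - bead k mu i) | i <- iota 0 k].

Lemma mem_skew_contents k l mu v : (forall i, row mu i <= row l i) ->
  size l <= k ->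
  reflect (exists2 c, skew_cell l mu c & v = content k c) (v \in skew_contents k l mu).
Proof.
move=> ml lk; apply: (iffP flatten_mapP) => [[i]|[[i j]]].
  rewrite !mem_iota => ik; rewrite /bead => vE; exists (i, v - (k - i.+1)).
    by rewrite /skew_cell /=; have := ml i; lia.
  by rewrite /content /=; lia.
rewrite /skew_cell /content /= => ij ->; exists i.
  rewrite mem_iota /=; apply: contraTT ij => ik.
  by rewrite [row l i]row_default; lia.
by rewrite mem_iota /bead; have := ml i; lia.
Qed.

(* Row [i] of the skew shape contributes the contents from [bead k mu i] up to
   [bead k l i] excluded, so the sum over each row telescopes. *)
Lemma count_skew_contents k l mu p : (forall i, row mu i <= row l i) ->
  count p (beads k l) + count p (skew_contents k l mu) =
  count p (beads k mu) + count p (map S (skew_contents k l mu)).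
Proof.
move=> ml; have tele m n : p (m + n) + count p (iota m n) = p m + count p (map S (iota m n)).
  by elim: n m => [|n IHn] m; rewrite ?addn0 //= addnS addnCA -addSn IHn.
rewrite /beads /mkseq /skew_contents; elim: (iota 0 k) => //= i s IHs.
rewrite map_cat !count_cat; have := tele (bead k mu i) (bead k l i - bead k mu i).
by rewrite subnKC ?leq_add2r //; lia.
Qed.

Lemma size_skew_contents k l mu : (forall i, row mu i <= row l i) -> size l <= k ->
  size mu <= k -> size (skew_contents k l mu) + sumn mu = sumn l.
Proof.
move=> ml lk mk; suff: size (skew_contents k l mu) + sumn (beads k mu) = sumn (beads k l).
  by rewrite !sumn_beads //; lia.
rewrite /beads /mkseq /skew_contents; elim: (iota 0 k) => //= i s IHs.
by rewrite size_cat size_iota -IHs /bead; have := ml i; lia.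
Qed.

Lemma uniq_flatten_map (T U : eqType) (F : T -> seq U) (s : seq T) :
  uniq s -> {in s, forall i, uniq (F i)} ->
  {in s &, forall i j v, v \in F i -> v \in F j -> i = j} ->
  uniq (flatten (map F s)).
Proof.
elim: s => //= i s IHs /andP[is_ us] uF dF; rewrite cat_uniq uF ?mem_head //=.
rewrite IHs //; first last.
- by move=> x y xs ys; apply: dF; rewrite inE ?xs ?ys orbT.
- by move=> x xs; apply: uF; rewrite inE xs orbT.
rewrite andbT; apply/hasPn => v /flatten_mapP[j js vj]; apply: contra is_ => vi.
by rewrite (dF i j _ _ v) ?inE ?eqxx ?js ?orbT.
Qed.

Lemma row_leq_size l mu : (forall i, row mu i <= row l i) -> is_partition mu ->
  size mu <= size l.
Proof.
move=> ml pm; have [//|ls] := leqP (size mu) (size l).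
by have := ml (size l); rewrite [row l _]row_default // leqNgt row_gt0 // ls.
Qed.

Lemma skew_cellE l mu i j : skew_cell l mu (i, j) = (row mu i <= j < row l i).
Proof. by []. Qed.

(** If two cells share a diagonal, the 2x2 square whose upper left corner is the higher one lies
    inside the skew shape. *)
Lemma content_inj t k l mu c d : is_partition l -> size l <= k ->
  rim_hook_removal t l mu -> skew_cell l mu c -> skew_cell l mu d ->
  content k c = content k d -> c = d.
Proof.
move=> pl lk [pm ml _ sq _].
have ltk c' : skew_cell l mu c' -> c'.1 < size l.
  by rewrite -row_gt0 // /skew_cell; lia.
suff H c' d' : skew_cell l mu c' -> skew_cell l mu d' -> content k c' = content k d' ->
    c'.1 <= d'.1 -> c' = d'.
  by move=> cs ds e; case/orP: (leq_total c.1 d.1) => h; [|apply: esym]; apply: H.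
case: c' d' => [i j] [i' j'] cs ds; have /= := ltk _ cs; have /= := ltk _ ds.
rewrite /content /= => i'l il e ii'; have [e'|] := eqVneq i i'.
  by subst i'; congr (_, _); lia.
move=> ne; have {ne}lt : i < i' by rewrite ltn_neqAle ne.
exfalso; have := sq i j; move: cs ds; rewrite !skew_cellE.
have := row_leq pm (leqnSn i); have := row_leq pl ii'; have := row_leq pl lt.
lia.
Qed.

(** Discrete intermediate value theorem: contents of adjacent cells differ by one. Rows are below
    [k], so the subtraction in [content] does not truncate. *)
Lemma path_content k l mu v c p : size l <= k ->
  path (fun x y => cell_adj x y && skew_cell l mu y) c p -> skew_cell l mu c ->
  content k c <= v <= content k (last c p) ->
  exists2 d, skew_cell l mu d & v = content k d.
Proof.
move=> lk; have ltk c' : skew_cell l mu c' -> c'.1 < k.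
  by rewrite /skew_cell; case: (ltnP c'.1 (size l)) => [|/row_default->]; lia.
elim: p c => [|d p IHp] c /=; first by move=> _ cs vc; exists c => //; lia.
case/andP=> /andP[adj ds] pd cs vE.
have [->|ne] := eqVneq v (content k c); first by exists c.
apply: (IHp d) => //; move: adj vE ne; have := ltk _ cs; have := ltk _ ds.
by rewrite /cell_adj /content; lia.
Qed.

(* The contents of a rim hook are distinct (no 2x2 square) and consecutive
   (connectedness), so they and their successors meet each residue class mod t once. *)
Lemma rim_hook_residue_count t k l mu r : is_partition l -> size l <= k ->
  rim_hook_removal t l mu -> r < t ->
  residue_count t r (beads k l) = residue_count t r (beads k mu).
Proof.
move=> pl lk rh rt; have [pm ml sm sq co] := rh.
have mk : size mu <= k by apply: leq_trans (row_leq_size ml pm) lk.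
set E := skew_contents k l mu.
have memE v := mem_skew_contents v ml lk.
have uE : uniq E.
  apply: uniq_flatten_map; rewrite ?iota_uniq //; first by move=> *; apply: iota_uniq.
  move=> i i'; rewrite !mem_iota /bead => /= ik i'k v vi vi'.
  have := ml i; have := ml i'; move=> h h'.
  have [] : (i, v - (k - i.+1)) = (i', v - (k - i'.+1)) => //.
  by apply: (content_inj pl lk rh); rewrite ?skew_cellE /content /=; move: vi vi';
    rewrite !mem_iota; lia.
have sE : size E = t by have := size_skew_contents ml lk mk; rewrite -/E; lia.
have iE x v z : x \in E -> z \in E -> x <= v <= z -> v \in E.
  move=> /memE[c cs ->] /memE[d ds ->] cvd; apply/memE.
  have [p [pp lp]] := co c d cs ds; rewrite -lp in cvd.
  exact: path_content pp cs cvd.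
have c1 := interval_residue_count uE sE iE rt.
have c2 : residue_count t r (map S E) = 1.
  apply: interval_residue_count rt; rewrite ?size_map ?(map_inj_uniq succn_inj) //.
  move=> x v z /mapP[x' x'E ->] /mapP[z' z'E ->] xvz; apply/mapP; exists v.-1; last by lia.
  by apply: iE x'E z'E _; lia.
have := count_skew_contents k (fun x => x %% t == r) ml.
by rewrite -!/(residue_count _ _ _) -/E c1 c2 !addn1 => -[].
Qed.

Lemma rim_hook_chain_residue_count t k l mu r : is_partition l -> size l <= k ->
  rim_hook_chain t l mu -> r < t ->
  residue_count t r (beads k l) = residue_count t r (beads k mu) /\ size mu <= k.
Proof.
move=> pl lk ch rt; elim: ch pl lk => // {l mu} l m n rh _ IH pl lk.
have [pm ml _ _ _] := rh; have mk : size m <= k by apply: leq_trans (row_leq_size ml pm) lk.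
by rewrite (rim_hook_residue_count pl lk rh rt); apply: IH.
Qed.

(** * Moving a bead removes a rim hook *)

(* The number of cells of content [v] is the difference of the numbers of beads
   beyond [v]. *)
Lemma skew_cell_content k l mu c (v := content k c) :
  is_partition l -> is_partition mu -> size l <= k -> skew_cell l mu c ->
  count (ltn v) (beads k mu) <= c.1 < count (ltn v) (beads k l).
Proof.
case: c => i j in v *; move=> pl pm lk; rewrite skew_cellE => /andP[mi li].
have ik : i < k by apply: leq_trans lk; rewrite -row_gt0 //; lia.
by rewrite /= -bead_gtP // leqNgt -bead_gtP // /bead /v /content /=; lia.
Qed.

Lemma skew_cell_exists k l mu v :
  is_partition l -> is_partition mu -> 
  count (ltn v) (beads k mu) < count (ltn v) (beads k l) ->
  exists2 c, skew_cell l mu c & content k c = v.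
Proof.
move=> pl pm; set i := count _ (beads k mu) => il.
have ik : i < k.
  by apply: leq_trans il _; rewrite (leq_trans (count_size _ _)) ?size_beads.
have li : v < bead k l i by rewrite bead_gtP.
have mi : bead k mu i <= v by rewrite leqNgt bead_gtP // ltnn.
exists (i, v - (k - i.+1)); last by rewrite /content /=; move: mi; rewrite /bead; lia.
by rewrite skew_cellE; move: li mi; rewrite /bead; lia.
Qed.

Lemma cell_adj_sym c d : cell_adj c d = cell_adj d c.
Proof. by rewrite /cell_adj; lia. Qed.

(** The number of beads beyond [v] drops by one exactly for [x - t <= v < x], so the skew shape has
    one cell of each of these [t] contents and no other cell. This excludes 2x2 squares, and
    connectedness follows by joining cells of successive contents. *)
Lemma rim_hook_of_bead_move t k l mu x :
  0 < t -> t <= x -> is_partition l -> is_partition mu -> size l <= k -> size mu <= k ->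
  perm_eq (x :: beads k mu) (x - t :: beads k l) ->
  rim_hook_removal t l mu.
Proof.
move=> t0 tx pl pm lk mk /permP cnt.
have cE v : count (ltn v) (beads k l) = (x - t <= v < x) + count (ltn v) (beads k mu).
  by have := cnt (ltn v); rewrite /=; lia.
have ml i : row mu i <= row l i.
  have [ik|ki] := ltnP i k; last by rewrite row_default ?(leq_trans mk).
  suff : bead k mu i <= bead k l i by rewrite leq_add2r.
  rewrite leqNgt bead_gtP //; have := ltnn (bead k l i); rewrite bead_gtP //.
  by move/negbT; apply: contra => h; rewrite cE; lia.
have cell c : skew_cell l mu c ->
    c.1 = count (ltn (content k c)) (beads k mu) /\ x - t <= content k c < x.
  by move=> /(skew_cell_content pl pm lk); rewrite cE; lia.
have cells v : x - t <= v < x -> exists2 c, skew_cell l mu c & content k c = v.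
  by move=> vx; apply: skew_cell_exists => //; rewrite cE vx.
have ltk c : skew_cell l mu c -> c.1 < k.
  by move=> cs; apply: leq_trans lk; rewrite -row_gt0 //; move: cs; rewrite /skew_cell; lia.
have inj c d : skew_cell l mu c -> skew_cell l mu d -> content k c = content k d -> c.1 = d.1.
  by move=> /cell[-> _] /cell[-> _] ->.
(* If the two cells were not adjacent, the diagonal successor of the higher one would be a second
   cell of the same content. *)
have adj c d : skew_cell l mu c -> skew_cell l mu d -> content k d = (content k c).+1 ->
    cell_adj c d.
  move=> cs ds; have := ltk c cs; have := ltk d ds.
  case: c d cs ds => [i j] [i' j'] cs ds /= i'k ik; rewrite /content /= => e.
  have [E|ne] := eqVneq i i'; first by rewrite /cell_adj /=; lia.
  have [E|ne'] := eqVneq i'.+1 i; first by rewrite /cell_adj /=; lia.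
  have [lt|ge] := ltnP i i'.
    have /inj-/(_ _ cs) : skew_cell l mu (i.+1, j.+1).
      have := row_leq pm (leqnSn i); have := row_leq pl lt.
      by move: cs ds; rewrite !skew_cellE; lia.
    by rewrite /content /=; lia.
  have lt : i'.+1 <= i by lia.
  have /inj-/(_ _ ds) : skew_cell l mu (i'.+1, j'.+1).
    have := row_leq pm (leqnSn i'); have := row_leq pl lt.
    by move: cs ds; rewrite !skew_cellE; lia.
  by rewrite /content /=; lia.
pose R y z := cell_adj y z && skew_cell l mu z.
pose conn c d := exists p, path R c p /\ last c p = d.
have conn_trans c d e : conn c d -> conn d e -> conn c e.
  move=> [p [pp <-]] [q [pq <-]]; exists (p ++ q).
  by rewrite cat_path pp last_cat.
have link n c d : skew_cell l mu c -> skew_cell l mu d -> content k d = content k c + n ->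
    conn c d /\ conn d c.
  elim: n c d => [|n IHn] c d cs ds e.
    suff -> : c = d by split; exists [::].
    have ii' : c.1 = d.1 by apply: inj => //; lia.
    by apply: injective_projections => //; move: e; rewrite /content ii'; lia.
  have [_ dx] := cell d ds; have [_ cx] := cell c cs.
  have [|c' cs' e'] := cells (content k c).+1; first by lia.
  have [|h1 h2] := IHn c' d cs' ds; first by lia.
  have ac := adj _ _ cs cs' e'.
  split; first by apply: conn_trans h1; exists [:: c']; rewrite /= /R ac cs'.
  by apply: conn_trans h2 _; exists [:: c]; rewrite /= /R cell_adj_sym ac cs.
split => //.
- have : sumn (x :: beads k mu) = sumn (x - t :: beads k l) by apply/perm_sumn/permP.
  by rewrite /= !sumn_beads //; lia.
- move=> i j; apply/negP => /and4P[cs _ _ ds]; have := inj _ _ cs ds.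
  by have := ltk _ ds; rewrite /content /=; lia.
move=> c d cs ds; have [le|le] := leqP (content k c) (content k d).
  by have [] := link (content k d - content k c) c d cs ds; first by lia.
by have [] := link (content k c - content k d) d c ds cs; first by lia.
Qed.

Lemma residue_count_subn t r x : t <= x -> ((x - t) %% t == r) = (x %% t == r).
Proof. by move=> tx; rewrite -[in RHS](subnK tx) modnDr. Qed.

Lemma bead_move t k l x : 0 < t -> is_partition l -> size l <= k ->
  x \in beads k l -> t <= x -> x - t \notin beads k l ->
  exists mu, [/\ is_partition mu, size mu <= k, rim_hook_removal t l mu
    & forall r, residue_count t r (beads k mu) = residue_count t r (beads k l)].
Proof.
move=> t0 pl lk xX tx xtX.
set s := x - t :: rem x (beads k l); have pr := perm_to_rem xX.
have us : uniq s.
  by rewrite /= rem_uniq ?beads_uniq // andbT; apply: contra xtX => /mem_rem.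
have ss : size s = k by rewrite -[RHS](size_beads k l) (perm_size pr).
have := part_of_beadsP us; set mu := part_of_beads s; rewrite ss => -[pm mk pmu].
exists mu; split=> // [|r].
  apply: (@rim_hook_of_bead_move _ k _ _ x) => //.
  apply/permP => p; move/permP: pmu => /(_ p) /=; move/permP: pr => /(_ p) /=; lia.
rewrite /residue_count (permP pmu) (permP pr) /=; congr (_ + _).
by rewrite residue_count_subn.
Qed.

(** Rim hook removals preserve the residue counts. Conversely, while the bead set is not closed, a
    bead move lowers [sumn l] and keeps the counts; once it is closed, the counts identify it with
    that of [sigma]. *)
Lemma core_isP t k l sigma : 0 < t -> is_partition l -> size l <= k ->
  is_partition sigma -> size sigma <= k -> is_core t sigma ->
  core_is t l sigma <->
  (forall r, r < t -> residue_count t r (beads k l) = residue_count t r (beads k sigma)).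
Proof.
move=> t0 pl lk ps sk cs; split=> [[ch _] r rt|].
  by case: (rim_hook_chain_residue_count pl lk ch rt).
move=> e; split=> //; have [n ln] := ubnP (sumn l); elim: n => // n IHn in l pl lk e ln *.
have [cl|] := boolP (all (fun x => (t <= x) ==> (x - t \in beads k l)) (beads k l)).
  suff -> : l = sigma by constructor.
  apply: (beads_inj pl ps lk sk); apply: (closed_eq t0) e; rewrite ?beads_uniq //.
    by move=> x xX; apply/implyP; apply: (allP cl).
  exact/(coreP t0).
rewrite -has_predC => /hasP[x xX /=]; rewrite negb_imply => /andP[tx xtX].
have [mu [pm mk rh em]] := bead_move t0 pl lk xX tx xtX.
have [_ _ sl _ _] := rh; apply: rhc_step rh _; apply: IHn => // [r rt|]; first by rewrite em e.
by lia.
Qed.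

(** * Counting closed bead sets *)

Lemma sum_residue_count b X : 0 < b -> \sum_(r < b) residue_count b r X = size X.
Proof.
move=> b0; elim: X => [|x X IHX]; first by rewrite big1.
rewrite /residue_count /= big_split /= -/(residue_count _ _ _) IHX -add1n; congr (_ + _).
rewrite (bigD1 (Ordinal (ltn_pmod x b0))) //= eqxx big1 // => i ne.
by apply/eqP; rewrite eqb0 eq_sym.
Qed.

Lemma sum_residue_class b m r (c : nat -> nat) : r < b ->
  \sum_(0 <= s < b * m | s %% b == r) c s = \sum_(0 <= q < m) c (r + b * q).
Proof.
move=> rb; elim: m => [|m IHm]; first by rewrite muln0 !big_geq.
rewrite (big_cat_nat (n := b * m)) ?leq_pmul2l //=; last by lia.
rewrite IHm big_nat_recr //=; congr (_ + _).
rewrite -{1}[b * m]add0n big_addn mulnS addnK big_mkord.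
rewrite (big_pred1 (Ordinal rb)) // => i; rewrite addnC mulnC modnMDl modn_small //.
Qed.

(** The closed bead set whose runner [s] mod [a] carries [c s] beads, pushed down to the lowest
    positions. *)
Definition abacus a (c : nat -> nat) : seq nat :=
  flatten [seq [seq s + a * j | j <- iota 0 (c s)] | s <- iota 0 a].

Lemma mem_abacus a c x : 0 < a -> (x \in abacus a c) = (x %/ a < c (x %% a)).
Proof.
move=> a0; apply/flatten_mapP/idP => [[s]|xc].
  rewrite mem_iota => sa /mapP[j]; rewrite mem_iota => jc ->.
  by rewrite addnC mulnC modnMDl divnMDl // modn_small ?divn_small ?addn0.
exists (x %% a); first by rewrite mem_iota ltn_pmod.
by apply/mapP; exists (x %/ a); rewrite ?mem_iota // addnC mulnC -divn_eq.
Qed.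

Lemma abacus_uniq a c : uniq (abacus a c).
Proof.
apply: uniq_flatten_map => [|s|s s']; first exact: iota_uniq.
  rewrite mem_iota => sa; rewrite map_inj_uniq ?iota_uniq // => i j /addnI /eqP.
  by rewrite eqn_pmul2l => [/eqP|]; lia.
rewrite !mem_iota => sa s'a v /mapP[j _ ->] /mapP[j' _ /(congr1 (modn^~ a))].
by rewrite ![_ + a * _]addnC ![a * _]mulnC !modnMDl !modn_small.
Qed.

Lemma residue_count_abacus b m r c : r < b ->
  residue_count b r (abacus (b * m) c) = \sum_(0 <= q < m) c (r + b * q).
Proof.
move=> rb; rewrite -sum_residue_class // /residue_count /abacus count_flatten sumnE.
rewrite !big_map /index_iota subn0 [RHS]big_mkcond; apply: eq_bigr => s _.
rewrite count_map (eq_count (a2 := fun _ => s %% b == r)) => [|j /=].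
  by case: eqP; rewrite ?count_predT ?size_iota ?count_pred0.
by rewrite -mulnA addnC mulnC modnMDl.
Qed.

Lemma residue_count_abacus1 a s c : s < a -> residue_count a s (abacus a c) = c s.
Proof.
by move=> sa; have := residue_count_abacus 1 c sa; rewrite muln1 big_nat1 muln0 addn0.
Qed.

Lemma abacus_closed a c x : 0 < a ->
  x \in abacus a c -> a <= x -> x - a \in abacus a c.
Proof.
move=> a0; rewrite !mem_abacus // => xc ax; move: xc.
by rewrite -{1 2}(subnK ax) modnDr divnDr ?divnn ?a0 //; lia.
Qed.

Lemma part_of_abacusP a c (k := size (abacus a c)) (l := part_of_beads (abacus a c)) :
  0 < a -> [/\ is_partition l, size l <= k, is_core a l & beads k l =i abacus a c].
Proof.
move=> a0; have := part_of_beadsP (abacus_uniq a c); rewrite -/k -/l => -[pl lk] /perm_mem e.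
split=> //; apply/(coreP a0 pl lk) => x; rewrite !e; exact: abacus_closed.
Qed.

Lemma core_eq_part_of_abacus a k l (c := fun s => residue_count a s (beads k l)) :
  0 < a -> is_partition l -> size l <= k -> is_core a l ->
  size (abacus a c) = k /\ l = part_of_beads (abacus a c).
Proof.
move=> a0 pl lk /(coreP a0 pl lk) cl.
have e : beads k l =i abacus a c.
  move=> x; rewrite mem_abacus //; exact: closed_memE a0 (beads_uniq k pl) cl x.
have sz : size (abacus a c) = k.
  rewrite -[RHS](size_beads k l); apply: perm_size; apply: uniq_perm => //.
    exact: abacus_uniq.
  exact: beads_uniq.
have [pl' lk' _ e'] := part_of_abacusP c a0; rewrite sz in lk' e'.
by split=> //; apply: (beads_inj pl pl' lk lk') => x; rewrite e e'.
Qed.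

Lemma sum_tuple_nth m n (t : m.-tuple 'I_n) :
  \sum_(0 <= q < m) nth 0 (map val t) q = \sum_(i <- t) i.
Proof.
by rewrite -[RHS](big_map val xpredT id) [RHS](big_nth 0) size_map size_tuple.
Qed.

(** Such cores correspond to a choice, for each [r], of a weak composition of [n r] into [m] parts,
    namely the bead counts on the runners [r + b * q] mod [a]. *)
Lemma card_cores_with_residues a b' m' k (n : nat -> nat) (b := b'.+1) (m := m'.+1) :
  a = b * m -> \sum_(r < b) n r = k ->
  card_is (fun l => [/\ is_partition l, is_core a l, size l <= k &
                     forall r, r < b -> residue_count b r (beads k l) = n r])
          (\prod_(r < b) 'C(m' + n r, m')).
Proof.
move=> ea sn; have a0 : 0 < a by rewrite ea.
(* Entries adding up to [n r] are at most [n r], so this finite type misses no composition. *)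
pose T (r : 'I_b) : finType := m.-tuple 'I_(n r).+1.
pose F (r : 'I_b) : pred (T r) := mem [set t : T r | \sum_(i <- t) i == n r].
pose c (f : {dffun forall r : 'I_b, T r}) s :=
  nth 0 (map val (f (inord (s %% b)))) (s %/ b).
have cE (f : {dffun forall r : 'I_b, T r}) (r : 'I_b) q :
    c f (r + b * q) = nth 0 (map val (f r)) q.
  rewrite /c addnC mulnC modnMDl divnMDl // modn_small // divn_small // addn0.
  by rewrite inord_val.
have c_res (f : {dffun forall r : 'I_b, T r}) r :
    f \in family F -> r < b -> residue_count b r (abacus a (c f)) = n r.
  move=> /familyP fF rb; have := fF (Ordinal rb); rewrite inE => /eqP <-.
  rewrite ea residue_count_abacus // -sum_tuple_nth.
  by apply: eq_bigr => q _; rewrite -cE.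
have c_size f : f \in family F -> size (abacus a (c f)) = k.
  move=> fF; rewrite -(@sum_residue_count b) // -sn.
  by apply: eq_bigr => r _; apply: c_res.
exists (map (fun f => part_of_beads (abacus a (c f))) 
  (enum (family F : pred {dffun forall r : 'I_b, T r}))).
split; last split.
(* Equal partitions have equal bead sets, whose counts mod [a] recover all tuple entries. *)
- rewrite map_inj_in_uniq ?enum_uniq // => f f'; rewrite !mem_enum => fF f'F e.
  have [pl lk _ be] := part_of_abacusP (c f) a0.
  have [_ _ _ be'] := part_of_abacusP (c f') a0.
  rewrite -e !c_size // in be be' lk.
  have ab : perm_eq (abacus a (c f)) (abacus a (c f')).
    by apply: uniq_perm; rewrite ?abacus_uniq // => x; rewrite -be be'.
  have cc s : s < a -> c f s = c f' s.
    move=> sa; have := permP ab (fun x => x %% a == s).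
    by rewrite -!/(residue_count _ _ _) !residue_count_abacus1.
  apply/ffunP => r; apply: val_inj; apply: (inj_map val_inj).
  apply: (@eq_from_nth _ 0) => [|q]; rewrite !size_map !size_tuple // => qm.
  rewrite -!cE; apply: cc; rewrite ea; have := ltn_ord r; nia.
- move=> l; split.
    case/mapP=> f; rewrite mem_enum => fF ->.
    have [pl lk cl be] := part_of_abacusP (c f) a0; rewrite c_size // in lk be.
    split=> // r rb; rewrite -(c_res f) //; apply/permP/uniq_perm => //.
      exact: beads_uniq.
    exact: abacus_uniq.
  case=> pl cl lk nl.
  have [] := core_eq_part_of_abacus a0 pl lk cl; set d := fun s => _ => sd le.
  have sumd r : r < b -> \sum_(0 <= q < m) d (r + b * q) = n r.
    move=> rb; rewrite -residue_count_abacus // -ea -nl //.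
    apply/permP/uniq_perm; rewrite ?abacus_uniq ?beads_uniq // => x.
    have [_ _ _ be] := part_of_abacusP d a0.
    by rewrite -be -le sd.
  (* This bound makes [inord] faithful in the definition of [f] below. *)
  have d_le (r : 'I_b) (q : 'I_m) : d (r + b * q) < (n r).+1.
    rewrite ltnS -(sumd r) // (bigD1_seq (q : nat)) ?mem_index_iota ?iota_uniq //=.
    exact: leq_addr.
  pose f : {dffun forall r : 'I_b, T r} :=
    [ffun r : 'I_b => [tuple inord (d (r + b * q)) | q < m]].
  have fd s : s < a -> c f s = d s.
    move=> sa; have sb : s %% b < b by rewrite ltn_pmod.
    have sm : s %/ b < m by rewrite ltn_divLR // mulnC -ea.
    have e : s = Ordinal sb + b * Ordinal sm by rewrite /= addnC mulnC -divn_eq.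
    rewrite e cE ffunE (nth_map ord0) ?size_tuple //.
    by rewrite -tnth_nth tnth_mktuple; apply: inordK (d_le (Ordinal sb) (Ordinal sm)).
  have abE : abacus a (c f) = abacus a d.
    rewrite /abacus; congr flatten; apply/eq_in_map => u.
    by rewrite mem_iota => /andP[_ ua]; rewrite fd.
  apply/mapP; exists f; last by rewrite abE.
  rewrite mem_enum; apply/familyP => r; rewrite inE -sum_tuple_nth.
  apply/eqP; rewrite -[RHS](sumd r) //; apply: eq_big_nat => q /andP[_ qm].
  by rewrite -cE fd // ea; have := ltn_ord r; nia.
rewrite size_map -cardE card_family foldrE big_image /=.
by apply: eq_bigr => r _; rewrite card_ord_partitions.
Qed.

(** * Quasipolynomiality *)

(** The first [k] beads move up by [b] and keep their residues; the [b] added empty rows put beads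
    on 0, ..., [b - 1], one per residue. *)
Lemma residue_count_beads_addn b r k l : size l <= k -> r < b ->
  residue_count b r (beads (k + b) l) = (residue_count b r (beads k l)).+1.
Proof.
move=> lk rb; rewrite /residue_count /beads /mkseq iotaD map_cat count_cat add0n -addn1.
congr (_ + _).
  rewrite !count_map; apply: eq_in_count => i; rewrite mem_iota => /= ik.
  by rewrite /bead (_ : k + b - i.+1 = (k - i.+1) + b) ?addnA ?modnDr //; lia.
apply: interval_residue_count rb; rewrite ?size_map ?size_iota //.
  rewrite map_inj_in_uniq ?iota_uniq // => i j; rewrite !mem_iota /bead => ik jk.
  by rewrite !row_default; lia.
move=> x v z /mapP[i _ ->] /mapP[j]; rewrite mem_iota /bead => jk -> vz.
move: vz; rewrite [row l j]row_default => [vz|]; last by lia.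
apply/mapP; exists (k + b - v.+1); first by rewrite mem_iota; lia.
by rewrite /bead row_default; lia.
Qed.

Lemma residue_count_beads_muln b r k l n : size l <= k -> r < b ->
  residue_count b r (beads (k + n * b) l) = residue_count b r (beads k l) + n.
Proof.
move=> lk rb; elim: n => [|n IHn]; first by rewrite !addn0.
by rewrite mulSnr addnA residue_count_beads_addn ?IHn ?addnS //; lia.
Qed.

Lemma card_is_ext (P P' : seq nat -> Prop) n :
  (forall x, P x <-> P' x) -> card_is P n -> card_is P' n.
Proof.
by move=> e [s [us [ms ss]]]; exists s; split=> //; split=> // x; rewrite ms.
Qed.

Lemma rim_hook_chain_size t l mu : 0 < t -> is_partition l ->
  rim_hook_chain t l mu -> size mu <= size l.
Proof.
by move=> t0 pl ch; case: (rim_hook_chain_residue_count pl (leqnn _) ch t0).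
Qed.

Lemma card_cores b m k sigma : 0 < b -> 0 < m -> is_partition sigma -> is_core b sigma ->
  size sigma <= k ->
  card_is (fun lam => [/\ is_partition lam, is_core (b * m) lam,
                          core_is b lam sigma & size lam <= k])
    (\prod_(r < b) 'C(m.-1 + residue_count b r (beads k sigma), m.-1)).
Proof.
case: b m => // b [//|m] _ _ ps cs sk.
apply: card_is_ext (card_cores_with_residues (k := k) (m' := m)
  (n := fun r => residue_count b.+1 r (beads k sigma)) erefl _); last first.
  by rewrite sum_residue_count // size_beads.
move=> l; split=> [[pl cl lk e]|[pl cl /core_isP e lk]]; split=> //.
  exact/(core_isP (k := k)).
exact: e.
Qed.

Local Open Scope ring_scope.

Lemma binomial_prod (R : numFieldType) m n :
  'C(m + n, m)%:R = (m`!%:R)^-1 * \prod_(q < m) (n%:R + m%:R - q%:R) :> R.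
Proof.
have m0 : m`!%:R != 0 :> R by rewrite pnatr_eq0 -lt0n fact_gt0.
apply: (mulfI m0); rewrite mulrA divff // mul1r -natrM mulnC bin_ffact ffact_prod.
rewrite natr_prod; apply: eq_bigr => q _.
by rewrite natrB -?natrD 1?addnC //; have := ltn_ord q; lia.
Qed.

(* In row r = p.1, the root is where n_r = n + d r - s makes n_r + m - p.2 vanish. *)
Definition core_poly b m (d : nat -> nat) (s : nat) : {poly rat} :=
  (m`!%:R ^+ b)^-1 *: \prod_(p : 'I_b * 'I_m) ('X - (s%:R - (d p.1)%:R - m%:R + p.2%:R)%:P).

Lemma size_core_poly b m d s : size (core_poly b m d s) = (b * m).+1.
Proof.
rewrite size_scale ?size_prod_XsubC; last first.
  by rewrite invr_eq0 expf_neq0 // pnatr_eq0 -lt0n fact_gt0.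
by rewrite /index_enum -enumT -cardE card_prod !card_ord.
Qed.

Lemma lead_coef_core_poly b m d s : lead_coef (core_poly b m d s) = (m`!%:R ^+ b)^-1.
Proof. by rewrite lead_coefZ (monicP (monic_prod_XsubC _ _ _)) mulr1. Qed.

(** The hypothesis says [x r = d r + n - s], written additively to avoid truncated subtraction; each
    binomial is then a product of [m] linear factors in [n]. *)
Lemma horner_core_poly b m d s (n : nat) (x : nat -> nat) :
  (forall r, (r < b)%N -> (x r + s = d r + n)%N) ->
  (core_poly b m d s).[n%:R] = (\prod_(r < b) 'C(m + x r, m))%:R.
Proof.
move=> e; rewrite hornerZ horner_prod natr_prod.
under [RHS]eq_bigr => r _ do rewrite binomial_prod.
rewrite big_split /= prodr_const card_ord exprVn; congr (_ * _).
rewrite pair_bigA /=; apply: eq_bigr => -[r q] _ /=; rewrite hornerXsubC.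
have := congr1 (fun y => y%:R : rat) (e r (ltn_ord r)); rewrite !natrD => er.
by rewrite (_ : (x r)%:R = (d r)%:R + n%:R - s%:R); [ring | rewrite -er addrK].
Qed.

Theorem theorem12 (a b : nat) (sigma : seq nat) :
  (0 < a)%N -> (b %| a)%N ->
  is_partition sigma -> is_core b sigma ->
  exists (Q : nat -> rat) (N : nat -> nat),
    (forall i, (i < b)%N ->
       exists P : {poly rat},
         [/\ forall n : nat, Q (i + n * b)%N = P.[n%:R],
             size P = (a - b).+1
           & lead_coef P = (((a %/ b).-1)`!%:R ^+ b)^-1]) /\
    (forall k : nat,
       card_is (fun lam => [/\ is_partition lam, is_core a lam,
                              core_is b lam sigma & (size lam <= k)%N]) (N k)) /\
    (forall k : nat, (size sigma <= k)%N -> (N k)%:R = Q k).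
Proof.
move=> a0 ba ps cs; have b0 : (0 < b)%N by apply: dvdn_gt0 ba.
have m0 : (0 < a %/ b)%N by rewrite divn_gt0 // dvdn_leq.
have ea : a = (b * (a %/ b))%N by rewrite mulnC divnK.
set m := (a %/ b)%N in m0 ea *; set M := size sigma.
pose c k r := residue_count b r (beads k sigma).
(* The residue [i] itself may be smaller than [M], where bead counts need not grow regularly. The
   base point [i + M * b] is at least [M], and the shift by [M] periods is undone inside
   [core_poly]. *)
pose P i := core_poly b m.-1 (c (i + M * b)%N) M.
(* Removing rim hooks never increases the length, so no partition with fewer than [M] parts has core
   [sigma]. *)
pose N k := if (M <= k)%N then (\prod_(r < b) 'C(m.-1 + c k r, m.-1))%N else 0%N.
exists (fun k => (P (k %% b)%N).[(k %/ b)%:R]), N; split; last split.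
- move=> i ib; exists (P i); split.
  + by move=> n; rewrite addnC modnMDl divnMDl // modn_small // divn_small // addn0.
  + by rewrite size_core_poly ea; congr _.+1; nia.
  + exact: lead_coef_core_poly.
- move=> k; rewrite /N; case: leqP => Mk; first by rewrite ea; apply: card_cores.
  exists [::]; split=> //; split=> // l; split=> // -[pl _ [ch _] lk].
  by have := rim_hook_chain_size b0 pl ch; rewrite leqNgt (leq_ltn_trans lk).
move=> k Mk; rewrite /N Mk /P; apply/esym/horner_core_poly => r rb.
(* Both sides become counts for [k + M * b] beads, since [k] is [k %% b] plus [k %/ b] periods. *)
rewrite /c -!residue_count_beads_muln //; last by rewrite -/M; nia.
by congr (residue_count b r (beads _ sigma)); have := divn_eq k b; lia.
Qed.
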